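(* There is a universal constant $C>0$ such that for every $m\in\mathbb{Z}^3\setminus\{0\}$, every $c\in\mathbb{Z}$, and every set $\mathcal{E}\subset\mathbb{Z}^3$ of diameter $R\ge1$, $$\#\left(\mathcal{E}\cap\{x\in\mathbb{Z}^3:\ \langle m,x\rangle=c\}\right)\le C\left(R+\frac{R^2}{|m_*|}\right).$$
   Context: For $m\in\mathbb{Z}^3\setminus\{0\}$, $m_*$ denotes $m$ divided by the greatest common divisor of its coordinates. $\langle\cdot,\cdot\rangle$ is the Euclidean inner product, $|\cdot|$ is the Euclidean norm, and diameter is with respect to Euclidean distance. *)

(* Defs.v *)
From mathcomp Require Import all_boot all_order all_algebra.
From mathcomp Require Import all_classical all_reals all_analysis.

Set Implicit Arguments.
Unset Strict Implicit.
Unset Printing Implicit Defensive.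

Import Order.TTheory GRing.Theory Num.Theory.

Local Open Scope classical_set_scope.
Local Open Scope ring_scope.

Definition inner n (x y : 'rV[int]_n) : int := \sum_i x 0 i * y 0 i.

(* The Euclidean norm; [`|x|] on matrices would be the sup norm. *)
Definition enorm (R : realType) n (x : 'rV[int]_n) : R :=
  Num.sqrt (inner x x)%:~R.

Definition gcd_coords n (m : 'rV[int]_n) : int := \big[gcdz/0]_i m 0 i.

(* [m_*]; the division is exact in each coordinate. *)
Definition primitive_part n (m : 'rV[int]_n) : 'rV[int]_n :=
  \row_i divz (m 0 i) (gcd_coords m).

(* [+oo] for an unbounded set and [-oo] for the empty set. *)
Definition diameter (R : realType) n (E : set 'rV[int]_n) : \bar R :=
  ereal_sup [set (enorm R (x - y))%:E | x in E & y in E].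

(* Main.v *)
Require Import Defs.
From mathcomp Require Import all_boot all_order all_algebra.
From mathcomp Require Import all_classical all_reals all_analysis.
From mathcomp Require Import zify ring lra.

Import Order.TTheory GRing.Theory Num.Theory.

Local Open Scope classical_set_scope.
Local Open Scope ring_scope.

(** Write p for the primitive part of m, and let k be a coordinate at which
    |p_k| is largest, so that |p| <= 2 |p_k|.  Dividing by the gcd of m, all the
    points to be counted lie in one plane <p, x> = const, so their differences d
    satisfy p_k d_k + p_i d_i + p_j d_j = 0, where i and j are the other two
    coordinates.  Put g = gcd(p_i, p_k) and h = |p_k| / g.

    The relation shows that g divides p_j d_j; as p is primitive, g is coprime
    to p_j, so g divides d_j.  Hence the j-th coordinates of the points are all
    congruent mod g.  Among points that share their j-th coordinate,
    p_i d_i = - p_k d_k, and dividing by g gives that h divides d_i.  Finally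
    d_j = d_i = 0 forces d_k = 0 ([plane_lattice]).

    Place the points in a box of half-side n = floor r around one of them, and
    cut the range of the j-th coordinate into intervals of length g and that of
    the i-th into intervals of length h.  By these congruences the pair of
    intervals determines the point ([counting_plane]), so there are at most
    (2r/g + 1)(2r/h + 1) points.  As gh = |p_k| >= |p|/2 and g, h >= 1, this is
    at most 8 (r + r^2/|p|) ([cell_count_le]). *)

Lemma dvdz_gcd_coords n (m : 'rV[int]_n) (d : int) :
  (d %| gcd_coords m)%Z = [forall i, (d %| m 0%R i)%Z].
Proof.
rewrite [LHS](big_morph (fun a => (d %| a)%Z) (dvdz_gcd d) (dvdz0 d)).
by rewrite big_all; apply/allP/forallP => dm i //; apply: dm;
  rewrite ?mem_index_enum.
Qed.

Lemma dvdz_gcd_coord n (m : 'rV[int]_n) i : (gcd_coords m %| m 0%R i)%Z.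
Proof. by apply/forallP: i; rewrite -dvdz_gcd_coords. Qed.

Lemma gcd_coords_eq0 n (m : 'rV[int]_n) : (gcd_coords m == 0) = (m == 0).
Proof.
rewrite -dvd0z dvdz_gcd_coords; apply/forallP/eqP => [m0|-> i].
  by apply/rowP=> i; rewrite mxE; apply/eqP; rewrite -dvd0z.
by rewrite mxE.
Qed.

Lemma primitive_partK n (m : 'rV[int]_n) :
  m = gcd_coords m *: primitive_part m.
Proof.
apply/rowP=> i; rewrite !mxE mulrC divzK //; exact: dvdz_gcd_coord.
Qed.

(** If d is the gcd of the coordinates of m_*, then d times the gcd of m still
    divides every coordinate of m, hence divides that gcd. *)
Lemma gcd_coords_primitive_part n (m : 'rV[int]_n) :
  m != 0 -> (gcd_coords (primitive_part m) %| 1)%Z.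
Proof.
rewrite -gcd_coords_eq0 => g0; set d := gcd_coords _.
rewrite -(dvdz_mul2l g0) mulr1 dvdz_gcd_coords; apply/forallP => i.
have -> : m 0 i = gcd_coords m * primitive_part m 0 i.
  by rewrite {1}[m]primitive_partK mxE.
rewrite dvdz_mul2l //; exact: dvdz_gcd_coord.
Qed.

Lemma innerZl n (a : int) (x y : 'rV[int]_n) : inner (a *: x) y = a * inner x y.
Proof.
by rewrite /inner mulr_sumr; apply: eq_bigr => i _; rewrite mxE mulrA.
Qed.

Lemma innerBr n (x y z : 'rV[int]_n) : inner x (y - z) = inner x y - inner x z.
Proof.
by rewrite /inner -sumrB; apply: eq_bigr => i _; rewrite !mxE mulrBr.
Qed.

(** The indices form the cyclic group of order 3, so that k, k + 1 and k + 2
    name a coordinate and the other two, uniformly in k. *)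
Lemma sum3_shift (V : nmodType) (F : 'I_3 -> V) (k : 'I_3) :
  \sum_i F i = F k + F (k + 1) + F (k + 2%:R).
Proof.
rewrite (reindex_inj (addrI k)) !big_ord_recl big_ord0.
rewrite [LHS]/= (addr0 k) (addr0 (F _)) (addrA (F _)).
by congr (_ + F _ + F _); apply: val_inj; case: k => [[|[|[]]]].
Qed.

Lemma ord3_shift (k l : 'I_3) : [\/ l = k, l = k + 1 | l = k + 2%:R].
Proof.
case: l k => [[|[|[|//]]] ?] [[|[|[|//]]] ?];
  by [constructor 1; apply: val_inj | constructor 2; apply: val_inj
     | constructor 3; apply: val_inj].
Qed.

Lemma row3_shift_eq (x y : 'rV[int]_3) (k : 'I_3) :
  x 0 k = y 0 k -> x 0 (k + 1) = y 0 (k + 1) ->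
  x 0 (k + 2%:R) = y 0 (k + 2%:R) -> x = y.
Proof. by move=> ? ? ?; apply/rowP => l; case: (ord3_shift k l) => ->. Qed.

Lemma normz_le_enorm (R : realType) n (x : 'rV[int]_n) i :
  `|x 0 i|%:~R <= enorm R x.
Proof.
rewrite -(ger0_norm (x := `|x 0 i|%:~R)) ?ler0z // -sqrtr_sqr /enorm.
rewrite ler_wsqrtr // -rmorphXn ler_int real_normK ?num_real //.
rewrite /inner (bigD1 i) //= expr2 lerDl sumr_ge0 // => j _.
by rewrite -expr2 sqr_ge0.
Qed.

Lemma enorm_gt0 (R : realType) n (x : 'rV[int]_n) : x != 0 -> 0 < enorm R x.
Proof.
move=> /rV0Pn [i xi]; apply: lt_le_trans (normz_le_enorm R _ x i).
by rewrite ltr0z normr_gt0.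
Qed.

(** The sharp constant is the square root of 3; 2 keeps the arithmetic
    rational. *)
Lemma enorm_le_max (R : realType) (x : 'rV[int]_3) (k : 'I_3) :
  (forall i, `|x 0 i| <= `|x 0 k|) -> enorm R x <= 2 * `|x 0 k|%:~R.
Proof.
move=> xk; set N := `|x 0 k| in xk *.
have -> : 2 * N%:~R = Num.sqrt ((4 * N ^+ 2)%:~R : R).
  rewrite -[LHS]ger0_norm; last by rewrite mulr_ge0 // ler0z.
  by rewrite -sqrtr_sqr; congr Num.sqrt; rewrite intrM rmorphXn /=; ring.
rewrite ler_wsqrtr // ler_int (@le_trans _ _ (\sum_(i < 3) N ^+ 2)) //.
  apply: ler_sum => i _; rewrite -expr2 -[x 0 i ^+ 2]real_normK ?num_real //.
  by rewrite lerXn2r ?nnegrE.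
rewrite sumr_const card_ord; have := sqr_ge0 N; lia.
Qed.

Lemma diameter_coord (R : realType) n (E : set 'rV[int]_n) (r : R) x y i :
  0 <= r -> diameter R E = r%:E -> E x -> E y ->
  (absz (x 0 i - y 0 i)%R <= Num.truncn r)%N.
Proof.
move=> r0 Er Ex Ey; rewrite truncn_ge_nat //.
have : ((enorm R (x - y))%:E <= r%:E)%E.
  by rewrite -Er; apply: ereal_sup_ubound; exists x => //; exists y.
rewrite lee_fin; apply: le_trans.
by have := normz_le_enorm R _ (x - y) i; rewrite !mxE -abszE pmulrn.
Qed.

Lemma counting_le_card (R : realType) (T : choiceType) (F : finType)
    (A : set T) (f : T -> F) :
  {in A &, injective f} -> (counting A <= (#|F|%:R : R)%:E)%E.
Proof.
move=> finj; pose g t : nat := enum_rank (f t).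
have ginj : {in A &, injective g}.
  by move=> s t As At /val_inj/enum_rank_inj; apply: finj.
have Acard : (A #<= `I_#|F|)%card.
  rewrite -(card_le_eql (inj_card_eq ginj)); apply: subset_card_le.
  by move=> _ [t _ <-] /=; apply: ltn_ord.
have Afin : finite_set A by apply: card_le_finite Acard _.
by rewrite /counting asboolT // lee_fin ler_nat geq_card_fset_set.
Qed.

(** The intervals are numbered from -n, so that the numbers are natural for z in
    [-n, n]; outside of it, the value has no meaning. *)
Definition cell (n d : nat) (z : int) : 'I_((2 * n) %/ d).+1 :=
  inord (absz (z + n)%R %/ d).

(** Two points of the same interval differ by less than d. *)
Lemma cell_inj (n d : nat) (z t : int) :
  (absz z <= n)%N -> (absz t <= n)%N -> (d > 0)%N -> (d %| z - t)%Z ->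
  cell n d z = cell n d t -> z = t.
Proof.
move=> zn tn d0 dvd /(congr1 val); rewrite /= !inordK ?ltnS ?leq_div2r //;
  try lia.
move=> cell_eq.
have zt_lt : (absz (z - t)%R < d)%N.
  have := divn_eq (absz (z + n)%R) d; have := divn_eq (absz (t + n)%R) d.
  have := ltn_pmod (absz (z + n)%R) d0; have := ltn_pmod (absz (t + n)%R) d0.
  rewrite cell_eq; lia.
have [|zt0] := posnP (absz (z - t)%R); first lia.
by move: dvd; rewrite dvdzE /= gtnNdvd.
Qed.

(** In the lattice orthogonal to a primitive p, the coordinate k + 2 is confined to
    a progression of difference g; where it vanishes, the coordinate k + 1 is
    confined to one of difference p_k / g; where both vanish, so does the last.
    The product of the two differences is p_k, which is what makes the final
    count inversely proportional to p_k. *)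
Lemma plane_lattice (p d : 'rV[int]_3) (k : 'I_3) :
  (gcd_coords p %| 1)%Z -> p 0 k != 0 -> inner p d = 0 ->
  let g := gcdz (p 0 (k + 1)) (p 0 k) in
  (g %| d 0%R (k + 2%:R)%R)%Z /\
  (d 0 (k + 2%:R) = 0 ->
    (divz (p 0%R k) g %| d 0%R (k + 1)%R)%Z /\ (d 0 (k + 1) = 0 -> d 0 k = 0)).
Proof.
move=> p1 pk + g; rewrite /inner (sum3_shift _ _ k) => pd.
have g0 : g != 0 by rewrite gcdz_eq0 negb_and pk orbT.
have [gi gk] : (g %| p 0%R (k + 1)%R)%Z /\ (g %| p 0%R k)%Z.
  by rewrite dvdz_gcdl dvdz_gcdr.
split=> [|d2].
  have copr : coprimez g (p 0 (k + 2%:R)).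
    suff: (gcdz g (p 0%R (k + 2%:R)%R) %| 1)%Z by rewrite dvdz1.
    apply: dvdz_trans p1.
    rewrite dvdz_gcd_coords; apply/forallP => l.
    case: (ord3_shift k l) => ->; last exact: dvdz_gcdr.
    - exact: dvdz_trans (dvdz_gcdl _ _) gk.
    - exact: dvdz_trans (dvdz_gcdl _ _) gi.
  rewrite -(Gauss_dvdzr _ copr).
  have -> : p 0 (k + 2%:R) * d 0 (k + 2%:R) =
      - (p 0 k * d 0 k + p 0 (k + 1) * d 0 (k + 1)) by lia.
  by rewrite rpredN rpredD // dvdz_mulr.
(* What remains is the relation p_k d_k + p_(k+1) d_(k+1) = 0. *)
move: pd; rewrite d2 mulr0 addr0 => pd; split=> [|d1]; last first.
  by move/eqP: pd; rewrite d1 mulr0 addr0 mulf_eq0 (negPf pk) => /eqP.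
have copr : coprimez (divz (p 0 k) g) (divz (p 0 (k + 1)) g).
  rewrite /coprimez -(inj_eq (mulfI g0)) mulr1; apply/eqP.
  rewrite -[X in X * _]/(Posz (absz g)) mulz_gcdr ![g * divz _ _]mulrC.
  by rewrite !divzK // gcdzC.
rewrite -(Gauss_dvdzr _ copr) -(dvdz_mul2l g0) mulrA.
rewrite ![g * divz _ _]mulrC !divzK //.
have -> : p 0 (k + 1) * d 0 (k + 1) = - (p 0 k * d 0 k) by lia.
by rewrite rpredN dvdz_mulr.
Qed.

Lemma exists_max_coord n (p : 'rV[int]_n) :
  p != 0 -> exists2 k, p 0 k != 0 & forall i, `|p 0 i| <= `|p 0 k|.
Proof.
move=> /rV0Pn[i pi].
have [k _ kmax] := arg_maxP (fun j => `|p 0 j|) (erefl : xpredT i).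
exists k => [|j]; last exact: kmax.
by rewrite -normr_gt0; apply: lt_le_trans (kmax i isT); rewrite normr_gt0.
Qed.

(** Here g = gcd(p_(k+1), p_k) and h = |p_k| / g.  The two intervals containing
    the coordinates k + 2 and k + 1 determine a point of A: first the coordinate
    k + 2, by its congruence mod g, and only then the coordinate k + 1, whose
    congruence mod h holds among points with equal coordinate k + 2. *)
Lemma counting_plane (R : realType) (p : 'rV[int]_3) (k : 'I_3) (n : nat)
    (A : set 'rV[int]_3) :
  (gcd_coords p %| 1)%Z -> p 0 k != 0 ->
  (forall x y, A x -> A y -> inner p x = inner p y) ->
  (forall x y i, A x -> A y -> (absz (x 0 i - y 0 i)%R <= n)%N) ->
  exists g h : nat, [/\ (0 < g)%N, (0 < h)%N, (g * h)%N = absz (p 0 k) &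
    (counting A <= (((2 * n %/ g).+1 * (2 * n %/ h).+1)%:R : R)%:E)%E].
Proof.
move=> p1 pk Ap An; pose g := gcdz (p 0 (k + 1)) (p 0 k).
have g_pk : (g %| p 0%R k)%Z by exact: dvdz_gcdr.
have gh : (absz g * absz (p 0%R k %/ g)%Z)%N = absz (p 0 k).
  by rewrite -abszM mulrC divzK.
have : (0 < absz g * absz (p 0%R k %/ g)%Z)%N by rewrite gh absz_gt0.
rewrite muln_gt0 => /andP[g0 h0].
exists (absz g), (absz (p 0%R k %/ g)%Z); split=> //.
(* The centre of the box; for empty A its value is irrelevant, since the
   injectivity to be proved is vacuous. *)
pose x0 : 'rV[int]_3 := xget 0 A.
have Ax0 x : A x -> A x0 by move=> Ax; apply: (xgetI _ Ax).
pose f (x : 'rV[int]_3) :=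
  (cell n (absz g) (x 0 (k + 2%:R) - x0 0 (k + 2%:R)),
   cell n (absz (p 0%R k %/ g)%Z) (x 0 (k + 1) - x0 0 (k + 1))).
rewrite -[X in (X * _)%N]card_ord -[X in (_ * X)%N]card_ord -card_prod.
apply: (@counting_le_card _ _ _ _ f) => x y /set_mem Ax /set_mem Ay.
move=> [/cell_inj e2 /cell_inj e1].
have pd : inner p (x - y) = 0 by rewrite innerBr (Ap _ _ Ax Ay) subrr.
have [dvd2 dvd1] := plane_lattice _ _ _ p1 pk pd.
have x0x := An _ _ _ Ax (Ax0 _ Ax); have x0y := An _ _ _ Ay (Ax0 _ Ax).
move: dvd2 dvd1; rewrite !mxE => dvd2 dvd1.
have {}e2 : x 0 (k + 2%:R) = y 0 (k + 2%:R).
  apply: (addIr (- x0 0 (k + 2%:R))); apply: e2 => //.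
  by rewrite opprB addrA subrK.
have [|{}dvd1 d0] := dvd1; first by rewrite e2 subrr.
have {}e1 : x 0 (k + 1) = y 0 (k + 1).
  apply: (addIr (- x0 0 (k + 1))); apply: e1 => //.
  by rewrite opprB addrA subrK.
apply: (row3_shift_eq _ _ k) => //.
by apply/eqP; rewrite -subr_eq0 d0 // e1 subrr.
Qed.

(** With u and v the two quotients, u v s <= 2 (u g)(v h) <= 8 r^2, while
    u, v <= 2 r and 1 <= r absorb the remaining terms u + v + 1 of (u + 1)(v + 1). *)
Lemma cell_count_le (R : realFieldType) (n g h : nat) (r s : R) :
  (0 < g)%N -> (0 < h)%N -> 1 <= r -> n%:R <= r ->
  0 < s -> s <= 2 * (g * h)%:R ->
  ((2 * n %/ g).+1 * (2 * n %/ h).+1)%:R <= 8 * (r + r ^+ 2 / s).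
Proof.
move=> g0 h0 r1 nr s0 sN.
set u := (2 * n %/ g)%N; set v := (2 * n %/ h)%N.
have ug : (u * g)%:R <= 2 * r :> R.
  apply: (@le_trans _ _ (2 * n)%:R); first by rewrite ler_nat; exact: leq_divM.
  by rewrite natrM ler_wpM2l.
have vh : (v * h)%:R <= 2 * r :> R.
  apply: (@le_trans _ _ (2 * n)%:R); first by rewrite ler_nat; exact: leq_divM.
  by rewrite natrM ler_wpM2l.
have u2 : u%:R <= 2 * r :> R by apply: le_trans ug; rewrite ler_nat leq_pmulr.
have v2 : v%:R <= 2 * r :> R by apply: le_trans vh; rewrite ler_nat leq_pmulr.
have uv : (u * v)%:R <= 8 * (r ^+ 2 / s).
  rewrite mulrA ler_pdivlMr //.
  have : (u * g)%:R * (v * h)%:R <= (2 * r) * (2 * r) :> R by rewrite ler_pM.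
  have : (u * v)%:R * s <= (u * v)%:R * (2 * (g * h)%:R) by rewrite ler_wpM2l.
  rewrite !natrM; nra.
by move: uv; rewrite !natrM -!natr1; lra.
Qed.

Theorem lemma3p10 (R : realType) :
  exists C : R, 0 < C /\
    forall (m : 'rV[int]_3) (c : int) (E : set 'rV[int]_3) (r : R),
      m != 0 -> 1 <= r -> diameter R E = r%:E ->
      (counting (E `&` [set x | inner m x = c]) <=
        (C * (r + r ^+ 2 / enorm R (primitive_part m)))%:E)%E.
Proof.
exists 8; split=> // m c E r m0 r1 Er.
have r0 : 0 <= r := le_trans ler01 r1.
have mE := primitive_partK _ m; set p := primitive_part m in mE *.
have p0 : p != 0 by apply: contra_neq m0 => p0; rewrite mE p0 scaler0.
have g0 : gcd_coords m != 0 by rewrite gcd_coords_eq0.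
have [k pk kmax] := exists_max_coord _ _ p0.
have [||g [h [g_gt0 h_gt0 gh]]] := counting_plane R p k (Num.truncn r)
    (E `&` [set x | inner m x = c]) (gcd_coords_primitive_part _ _ m0) pk.
- move=> x y [_ /= mx] [_ /= my]; apply: (mulfI g0).
  by rewrite -!innerZl -mE mx my.
- by move=> x y i [Ex _] [Ey _]; apply: diameter_coord Er Ex Ey.
move/le_trans; apply; rewrite lee_fin; apply: cell_count_le => //.
- by rewrite truncn_le.
- exact: enorm_gt0.
- by rewrite gh natr_absz; apply: enorm_le_max.
Qed.
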